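(* Let $n\geqslant 0$ and $i\geqslant 0$ be integers. Let $\Delta_i\colon C_\bullet(\Delta^n)\to C_\bullet(\Delta^n)\otimes C_\bullet(\Delta^n)$ be the Steenrod cup-$i$ coproduct, and for a consistent set $U\in\mathcal{B}([0,n],i+1)$ let $\Delta_i^U$ be the associated coproduct. If $i$ is even, then $$\Delta_{i}^{\emptyset} = (-1)^{i/2}\Delta_{i} \quad\text{and}\quad \Delta_{i}^{\binom{[0,n]}{i+2}} = (-1)^{i/2}\, T\Delta_{i}.$$ If $i$ is odd, then $$\Delta_{i}^{\emptyset} = (-1)^{\lceil i/2\rceil}\,T\Delta_{i} \quad\text{and}\quad \Delta_{i}^{\binom{[0,n]}{i+2}} = (-1)^{\lfloor i/2\rfloor}\Delta_{i}.$$
   Context: Notation. $[p,q]=\{p,p+1,\dots,q\}$, $(p,q)=[p,q]\setminus\{p,q\}$. $\binom{S}{k}$ is the set of $k$-element subsets of $S$; $|S|$ is the cardinality; $|S|_{<x}=|\{s\in S: s<x\}|$, $|S|_{>x}=|\{s\in S:s>x\}|$. Chains. $C_\bullet(\Delta^n)$ is the chain complex of free $\mathbb{Z}$-modules with basis the non-empty subsets $X\subseteq[0,n]$ (faces of the $n$-simplex), $X$ in degree $|X|-1$, with $\partial\{v_0<\dots<v_q\}=\sum_{p=0}^q(-1)^p\{v_0,\dots,\hat v_p,\dots,v_q\}$ for $q\geqslant1$ and $\partial=0$ in degree $0$. On the tensor product, $T(x\otimes y)=(-1)^{\deg x\deg y}\,y\otimes x$. Steenrod coproduct. An overlapping partition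 $\mathcal{L}=(L_0,\dots,L_{i+1})$ of $[0,n]$ is a family of intervals $L_p=[l_p,l_{p+1}]$ with $0=l_0\leqslant l_1<l_2<\dots<l_{i+1}\leqslant l_{i+2}=n$. Then $$\Delta_i([0,n])=\sum_{\mathcal{L}}(-1)^{\varepsilon(\mathcal{L})}(L_0\cup L_2\cup\cdots)\otimes(L_1\cup L_3\cup\cdots),$$ the sum over all overlapping partitions of $[0,n]$ into $i+2$ intervals, where $\varepsilon(\mathcal{L})=\mathsf{sign}(w_{\mathcal{L}})+in \in\mathbb{Z}/2\mathbb{Z}$, and $\mathsf{sign}(w_{\mathcal L})\in\mathbb{Z}/2\mathbb{Z}$ is the parity of the permutation putting $0,1,\dots,n$ into the order $[0,l_1],[l_2,l_3],\dots,(l_1,l_2),(l_3,l_4),\dots$. On a lower-dimensional face $S=\{v_0<\dots<v_m\}$, $\Delta_i(S)$ is given by the same formula for $[0,m]$ (with $n$ replaced by $m$), relabelled via $j\mapsto v_j$. Consistent sets. $\mathcal{B}([0,n],i+1)$ is the set of consistent subsets $U\subseteq\binom{[0,n]}{i+2}$: for every $M=\{m_0<\dots<m_{i+2}\}\in\binom{[0,n]}{i+3}$, the set of $K\in U$ with $K\subset M$ is a beginning or an ending segment (possibly empty or everything) of $M\setminus m_{i+2}<\dots<M\setminus m_1<M\setminus m_0$. In particular $\emptyset$ and $\binom{[0,n]}{i+2}$ are consistent. The coproduct $\Delta_i^U$. For $U\in\mathcal{B}([0,n],i+1)$, non-empty $S\subseteq[0,n]$ and $L\in\binom{S}{i+1}$,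 let $A=A_L^{U,S}$ be the set of $a\in S\setminus L$ such that either $L\cup\{a\}\in U$ and $|L|_{>a}$ is even, or $L\cup\{a\}\notin U$ and $|L|_{>a}$ is odd; let $B=B_L^{U,S}=S\setminus(L\cup A)$. Then $$\Delta_i^U(S)=\sum_{L\in\binom{S}{i+1}}(-1)^{\varepsilon_S(L,A,B)}\,(L\cup A)\otimes(L\cup B),\qquad \varepsilon_S(L,A,B)=\sum_{b\in B}|A|_{<b}+\sum_{l\in L}|L|_{<l}+|S|\,|A|,$$ (so $\Delta_i^U(S)=0$ if $|S|\leqslant i$), extended linearly. *)

(* Defs.v *)
From mathcomp Require Import all_boot all_algebra all_fingroup.

Set Implicit Arguments.
Unset Strict Implicit.
Unset Printing Implicit Defensive.

Import GRing.Theory.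
Local Open Scope ring_scope.

(* The free Z-module C(Delta^n) is modelled as integer-valued functions on its
   finite basis, and the tensor square as functions on pairs of basis elements.
   The differential is omitted: only the underlying graded modules matter
   here. *)

Definition face (n : nat) := {X : {set 'I_n.+1} | X != set0}.

Definition deg n (F : face n) : nat := #|val F|.-1.

Definition chain (n : nat) := {ffun face n -> int^o}.

Definition chain2 (n : nat) := {ffun face n * face n -> int^o}.

(* Total in X for convenience; it is 0 for X = set0, a case that never occurs in
   the coproducts below. *)
Definition basis_chain n (X : {set 'I_n.+1}) : chain n :=
  [ffun F => (val F == X)%:R].

Definition tensor n (x y : chain n) : chain2 n := [ffun p => x p.1 * y p.2].

(* T (x (x) y) = (-1)^(deg x deg y) y (x) x on basis elements. *)
Definition swap n (t : chain2 n) : chain2 n :=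
  [ffun p => (-1) ^+ (deg p.1 * deg p.2) * t (p.2, p.1)].

Definition linear_ext n (g : {set 'I_n.+1} -> chain2 n) (c : chain n) :
    chain2 n :=
  \sum_(F : face n) c F *: g (val F).

Section OverlappingPartitions.

Variables (m i : nat).

(* An overlapping partition of [0,m] into i+2 intervals is given by its
   endpoints l_0, ..., l_{i+2}; the p-th interval is [l_p, l_{p+1}]. *)
Implicit Type l : {ffun 'I_i.+3 -> 'I_m.+1}.

Definition lower l (p : 'I_i.+2) : 'I_m.+1 := l (widen_ord (leqnSn _) p).
Definition upper l (p : 'I_i.+2) : 'I_m.+1 := l (lift ord0 p).

Definition overlapping_partition l : bool :=
  [&& l ord0 == ord0, l ord_max == ord_max &
      [forall p : 'I_i.+2,
         if (0 < p < i.+1)%N then (lower l p < upper l p)%N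
         else (lower l p <= upper l p)%N]].

Definition interval l (p : 'I_i.+2) : {set 'I_m.+1} :=
  [set x : 'I_m.+1 | (lower l p <= x <= upper l p)%N].

Definition even_part l : {set 'I_m.+1} :=
  \bigcup_(p : 'I_i.+2 | ~~ odd p) interval l p.
Definition odd_part l : {set 'I_m.+1} :=
  \bigcup_(p : 'I_i.+2 | odd p) interval l p.

End OverlappingPartitions.

Section Rearrangement.

Variables (m : nat) (E : {set 'I_m.+1}).

Definition rearranged : seq 'I_m.+1 := enum E ++ enum (~: E).

Lemma size_rearranged : size rearranged = m.+1.
Proof. by rewrite size_cat -!cardE cardsC card_ord. Qed.

Lemma rearranged_uniq : uniq rearranged.
Proof.
rewrite cat_uniq !enum_uniq andbT; apply/hasPn => x.
by rewrite !mem_enum inE.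
Qed.

Lemma rearranged_inj : injective (fun p : 'I_m.+1 => nth ord0 rearranged p).
Proof.
move=> p q /eqP.
by rewrite nth_uniq ?size_rearranged ?rearranged_uniq // => /eqP/val_inj.
Qed.

Definition rearrangement : {perm 'I_m.+1} := perm rearranged_inj.

End Rearrangement.

(* For an overlapping partition the even-indexed intervals are disjoint and
   increasing, so listing their union increasingly gives [0,l_1],[l_2,l_3],...;
   the complement listed increasingly is (l_1,l_2),(l_3,l_4),..., where the last
   gap is (l_{i+1},m] when i is even. *)
Definition steenrod_sign m i (l : {ffun 'I_i.+3 -> 'I_m.+1}) : nat :=
  (odd_perm (rearrangement (even_part l)) + i * m)%N.

(* j |-> v_j for S = {v_0 < v_1 < ...} *)
Definition vertex n (S : {set 'I_n.+1}) (j : 'I_#|S|.-1.+1) : 'I_n.+1 :=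
  nth ord0 (enum S) j.
Arguments vertex {n} S j.

Definition steenrod_face n i (S : {set 'I_n.+1}) : chain2 n :=
  let m := #|S|.-1 in
  \sum_(l : {ffun 'I_i.+3 -> 'I_m.+1} | overlapping_partition l)
    (-1) ^+ steenrod_sign l *:
      tensor (basis_chain (vertex S @: even_part l))
             (basis_chain (vertex S @: odd_part l)).

Definition steenrod n i : chain n -> chain2 n :=
  linear_ext (@steenrod_face n i).
Arguments steenrod : clear implicits.

Definition ksubsets n (k : nat) : {set {set 'I_n.+1}} :=
  [set K : {set 'I_n.+1} | #|K| == k].
Arguments ksubsets : clear implicits.

(* M \ m_last < ... < M \ m_1 < M \ m_0 *)
Definition packet n (M : {set 'I_n.+1}) : seq {set 'I_n.+1} :=
  [seq M :\ x | x <- rev (enum M)].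

Definition consistent n k (U : {set {set 'I_n.+1}}) : bool :=
  (U \subset ksubsets n k.+1) &&
  [forall M in ksubsets n k.+2,
     let UM := [seq K <- packet M | K \in U] in
     prefix UM (packet M) || suffix UM (packet M)].

(* B([0,n],k) *)
Definition bruhat n k := {U : {set {set 'I_n.+1}} | consistent k U}.
Arguments bruhat : clear implicits.

Lemma consistent0 n k : consistent k (set0 : {set {set 'I_n.+1}}).
Proof.
rewrite /consistent sub0set; apply/forall_inP => M _ /=.
rewrite (eq_filter (a2 := pred0)) ?filter_pred0 ?prefix0s // => K.
by rewrite inE.
Qed.

Lemma consistent_full n k : consistent k (ksubsets n k.+1).
Proof.
rewrite /consistent subxx; apply/forall_inP => M; rewrite inE => /eqP cardM /=.
suff /all_filterP -> : all (mem (ksubsets n k.+1)) (packet M).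
  by rewrite prefix_refl.
apply/allP => _ /mapP[x + ->]; rewrite mem_rev mem_enum => xM.
by rewrite !inE; move: cardM; rewrite (cardsD1 x M) xM add1n => -[->].
Qed.

Definition bruhat0 n k : bruhat n k := exist _ set0 (consistent0 n k).
Definition bruhat_full n k : bruhat n k :=
  exist _ (ksubsets n k.+1) (consistent_full n k).
Arguments bruhat0 : clear implicits.
Arguments bruhat_full : clear implicits.

Definition count_lt n (S : {set 'I_n.+1}) (x : 'I_n.+1) : nat :=
  #|[set s in S | (s < x)%N]|.
Definition count_gt n (S : {set 'I_n.+1}) (x : 'I_n.+1) : nat :=
  #|[set s in S | (x < s)%N]|.

Section BruhatCoproduct.

Variables (n i : nat) (U : bruhat n i.+1).
Implicit Types S L A B : {set 'I_n.+1}.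

Definition partA S L : {set 'I_n.+1} :=
  [set a in S :\: L |
     ((a |: L \in val U) && ~~ odd (count_gt L a))
     || ((a |: L \notin val U) && odd (count_gt L a))].

Definition partB S L : {set 'I_n.+1} := S :\: (L :|: partA S L).

Definition bruhat_sign S L A B : nat :=
  (\sum_(b in B) count_lt A b + \sum_(l in L) count_lt L l + #|S| * #|A|)%N.

Definition bruhat_coproduct_face S : chain2 n :=
  \sum_(L : {set 'I_n.+1} | (L \subset S) && (#|L| == i.+1))
    (-1) ^+ bruhat_sign S L (partA S L) (partB S L) *:
      tensor (basis_chain (L :|: partA S L)) (basis_chain (L :|: partB S L)).

Definition bruhat_coproduct : chain n -> chain2 n :=
  linear_ext bruhat_coproduct_face.

End BruhatCoproduct.

(* Main.v *)
(** Listing the interior endpoints l_1 < ... < l_(i+1) identifies overlapping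
    partitions with (i+1)-subsets L.  A vertex x outside L lies in the interval
    whose index is the number of elements of L below x, so the even-indexed
    (odd-indexed) intervals cover L together with the x having evenly (oddly)
    many elements of L below.  When U is empty or full, A is cut out by the
    parity of the number of elements of L above x; the two numbers add up to
    i+1, hence {L u A, L u B} is the pair {even part, odd part}, in an order
    depending on the parity of i.

    For the signs, the Steenrod permutation has as many inversions as there are
    pairs (y, e) with e in the even part, y outside it and y < e.  Splitting
    the even part into L and A (or B) leaves a sum over L of constant parity and
    a count of pairs in A x B, which matches the Bruhat sign modulo
    sum_L |L|_(<l) = i(i+1)/2, whose parity is that of ceil(i/2). *)

Require Import Defs.
From mathcomp Require Import all_boot all_algebra all_fingroup.
From mathcomp Require Import zify.

Set Implicit Arguments.
Unset Strict Implicit.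
Unset Printing Implicit Defensive.

Import GRing.Theory Num.Theory.
Local Open Scope ring_scope.

(** * Parity of the rearrangement *)

(* Permuting the nodes of a Vandermonde determinant multiplies it by the sign
   of the permutation; with nodes 0, 1, ..., n-1 the sign of the permuted
   product is read off factor by factor. *)
Lemma odd_perm_inversions n (s : 'S_n) :
  odd_perm s = odd (\sum_(i < n) \sum_(j < n | (i < j)%N) (s j < s i)%N)%N.
Proof.
pose a : 'rV[int]_n := \row_j (j : nat)%:R.
have : Num.sg (\det (Vandermonde n (col_perm s a)))
       = Num.sg (\det (col_perm s (Vandermonde n a))).
  by congr (Num.sg (\det _)); apply/matrixP => i j; rewrite !mxE.
rewrite col_permE det_mulmx det_perm odd_permV sgrM !det_Vandermonde.
rewrite !(big_morph _ (@sgrM _) (@sgr1 _)).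
(* The unpermuted product has only positive factors, since its nodes increase, so its sign is 1. *)
rewrite [X in _ = X * _]big1 => [|i _]; last first.
  rewrite (big_morph _ (@sgrM _) (@sgr1 _)) big1 // => j ij.
  by rewrite !mxE gtr0_sg // subr_gt0 ltr_nat.
rewrite mul1r (eq_bigr (fun i : 'I_n =>
  (-1) ^+ (\sum_(j < n | (i < j)%N) (s j < s i)%N)%N)) => [|i _]; last first.
  rewrite (big_morph _ (@sgrM _) (@sgr1 _)).
  rewrite (big_morph _ (@exprD _ _) (@expr0 _ _)).
  apply: eq_bigr => j ij; rewrite !mxE.
  have : s i != s j by rewrite (inj_eq perm_inj) -val_eqE /= neq_ltn ij.
  rewrite -val_eqE /= neq_ltn => /orP[] lt.
    by rewrite gtr0_sg ?subr_gt0 ?ltr_nat // ltnNge (ltnW lt).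
  by rewrite ltr0_sg ?subr_lt0 ?ltr_nat // lt.
rewrite -(big_morph _ (@exprD _ _) (@expr0 _ _)).
rewrite -signr_odd => e; apply/esym/(@signr_inj int); rewrite e.
by case: (odd_perm s).
Qed.

Lemma sorted_ltn_enum m (E : {set 'I_m}) : sorted ltn (map val (enum E)).
Proof.
rewrite sorted_map /enum_mem -enumT; apply: sorted_filter.
  by move=> x y z /=; apply: ltn_trans.
by rewrite -sorted_map val_enum_ord iota_ltn_sorted.
Qed.

Lemma index_enum_ltn m (E : {set 'I_m}) x y : x \in E -> y \in E ->
  (index x (enum E) < index y (enum E))%N = (x < y)%N.
Proof.
move=> xE yE; have mono u v : u \in E -> v \in E ->
    (index u (enum E) < index v (enum E))%N -> (u < v)%N.
  move=> uE vE; have := sorted_ltn_enum E; rewrite sorted_map => srt.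
  apply: (sorted_ltn_index (leT := relpre val ltn)) => //.
  - by move=> ? ? ? /=; apply: ltn_trans.
  - by rewrite mem_enum.
  - by rewrite mem_enum.
apply/idP/idP; first exact: mono.
move=> xy; rewrite ltnNge leq_eqVlt; apply/norP; split.
  apply/eqP => /index_inj; rewrite !mem_enum => /(_ x yE xE) e.
  by rewrite e ltnn in xy.
by apply/negP => /mono => /(_ yE xE); lia.
Qed.

(** An inversion is a pair y < x with x listed before y. Within [E] and within its complement the
    listing is increasing, so inversions occur only for x in [E] and y outside. *)
Lemma odd_rearrangement m (E : {set 'I_m.+1}) :
  odd_perm (rearrangement E) = odd (\sum_(y in ~: E) count_gt E y).
Proof.
pose r := rearrangement E.
(* [r] sends positions to values; its inverse gives the position of a value in the list. *)
have idx x : (r^-1%g x : nat) = index x (rearranged E).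
  rewrite -{2}(permKV r x) [r _]permE.
  rewrite index_uniq ?rearranged_uniq // size_rearranged.
  exact: ltn_ord.
rewrite odd_perm_inversions -/r; congr odd.
transitivity (\sum_(y : 'I_m.+1) \sum_(x : 'I_m.+1)
    ((r^-1%g x < r^-1%g y) && (y < x)))%N.
  rewrite exchange_big /= (reindex_inj (@perm_inj _ r^-1%g)).
  apply: eq_bigr => x _; rewrite big_mkcond (reindex_inj (@perm_inj _ r^-1%g)).
  by apply: eq_bigr => y _; rewrite !permKV; case: ifP.
rewrite [RHS]big_mkcond /=; apply: eq_bigr => y _.
have idxE x : x \in E -> (index x (enum E) < size (enum E))%N.
  by rewrite index_mem mem_enum.
have := idxE y; rewrite inE /count_gt -sum1dep_card.
case: (boolP (y \in E)) => yE idxy /=.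
  (* For y in [E], a larger x is always listed after y, whether it lies in [E] or not. *)
  apply: big1 => x _; rewrite !idx !index_cat !mem_enum yE.
  case: (boolP (x \in E)) => xE /=; first by rewrite index_enum_ltn //; lia.
  by rewrite ltnNge (leq_trans (ltnW (idxy isT))) ?leq_addr.
rewrite [RHS]big_mkcond /=; apply: eq_bigr => x _.
rewrite !idx !index_cat !mem_enum (negbTE yE).
case: (boolP (x \in E)) => xE /=.
  by rewrite ltn_addr ?idxE //; case: ifP.
rewrite ltn_add2l index_enum_ltn ?inE //.
by case: (ltngtP x y).
Qed.

(** * Overlapping partitions as vertex subsets *)

(** The ambient set [S] is kept as a parameter so that the description is stable under increasing
    relabellings. *)
Definition even_blocks n (S L : {set 'I_n.+1}) : {set 'I_n.+1} :=
  L :|: [set x in S :\: L | ~~ odd (count_lt L x)].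
Definition odd_blocks n (S L : {set 'I_n.+1}) : {set 'I_n.+1} :=
  L :|: [set x in S :\: L | odd (count_lt L x)].

Section Cuts.

Variables m i : nat.
Implicit Type l : {ffun 'I_i.+3 -> 'I_m.+1}.

(** Only the interior endpoints l_1, ..., l_(i+1) are kept; the outer two are forced to be 0 and
    m. *)
Definition cuts l : {set 'I_m.+1} := [set l (inord p.+1) | p : 'I_i.+1].

Lemma lowerE l (p : 'I_i.+2) : lower l p = l (inord p).
Proof.
by congr (l _); apply: val_inj; rewrite /= inordK //; have := ltn_ord p; lia.
Qed.

Lemma upperE l (p : 'I_i.+2) : upper l p = l (inord p.+1).
Proof.
by congr (l _); apply: val_inj; rewrite /= inordK //; have := ltn_ord p; lia.
Qed.

(** Indices become natural numbers passed through [inord], which permits induction and plain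
    arithmetic on them. *)
Lemma overlapping_partitionP l :
  reflect [/\ l (inord 0) = ord0, l (inord i.+2) = ord_max,
     forall p, (p < i.+2)%N -> (l (inord p) <= l (inord p.+1))%N &
     forall p, (0 < p < i.+1)%N -> (l (inord p) < l (inord p.+1))%N]
    (overlapping_partition l).
Proof.
have -> : inord 0 = ord0 :> 'I_i.+3 by apply: val_inj; rewrite /= inordK.
have -> : inord i.+2 = ord_max :> 'I_i.+3 by apply: val_inj; rewrite /= inordK.
apply: (iffP and3P) => [[/eqP l0 /eqP lm /forallP lp]|[l0 lm le lt]].
  split=> // p p_i.
    have := lp (Ordinal p_i); rewrite lowerE upperE /=.
    by case: ifP => // _; apply: ltnW.
  have p_i' : (p < i.+2)%N by lia.
  by have := lp (Ordinal p_i'); rewrite lowerE upperE /= p_i.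
split; [exact/eqP | exact/eqP |].
apply/forallP => p; rewrite lowerE upperE; case: ifP => // [/lt //|_].
exact: le.
Qed.

Section Partition.

Variables (l : {ffun 'I_i.+3 -> 'I_m.+1}) (lP : overlapping_partition l).

Lemma partition_leq p q : (p <= q <= i.+2)%N ->
  (l (inord p) <= l (inord q))%N.
Proof.
case/overlapping_partitionP: lP => _ _ le _.
elim: q => [|q IH] /andP[pq qi]; first by rewrite (_ : p = 0)%N //; lia.
move: pq; rewrite leq_eqVlt => /orP[/eqP -> //|pq].
by apply: leq_trans (le q _); rewrite ?IH //; lia.
Qed.

(** Both indices are interior, because l_0 = l_1 and l_(i+1) = l_(i+2) are allowed. *)
Lemma partition_ltn p q : (0 < p)%N -> (p < q < i.+2)%N ->
  (l (inord p) < l (inord q))%N.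
Proof.
case/overlapping_partitionP: lP => _ _ _ lt p0 /andP[pq qi].
apply: leq_trans (lt p _) _; first by lia.
by apply: partition_leq; lia.
Qed.

Lemma cut_inj : injective (fun p : 'I_i.+1 => l (inord p.+1)).
Proof.
move=> p q e; apply: ord_inj; have := ltn_ord p; have := ltn_ord q => hq hp.
have irrefl r : (l (inord r) < l (inord r))%N = false by rewrite ltnn.
case: (ltngtP p q) => // pq.
  by suff: false by []; rewrite -(irrefl p.+1) {2}e partition_ltn //; lia.
by suff: false by []; rewrite -(irrefl q.+1) -{2}e partition_ltn //; lia.
Qed.

Lemma card_cuts : #|cuts l| = i.+1.
Proof. by rewrite card_imset ?card_ord //; apply: cut_inj. Qed.

(** By monotonicity exactly l_1, ..., l_p lie below x. The disjunctions drop the bound by an outer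
    endpoint, which is not a cut. *)
Lemma count_lt_cuts (p : nat) (x : 'I_m.+1) : (p < i.+2)%N ->
  (p = 0 \/ l (inord p) < x)%N -> (p = i.+1 \/ x <= l (inord p.+1))%N ->
  count_lt (cuts l) x = p.
Proof.
move=> p_i lo up.
have -> : count_lt (cuts l) x = #|[set q : 'I_i.+1 | (q < p)%N]|.
  rewrite -(card_imset _ cut_inj) /count_lt; congr #|pred_of_set _|.
  apply/setP => y; rewrite inE; apply/andP/imsetP.
    case=> /imsetP[q _ ->] qx; exists q; rewrite ?inE //.
    rewrite ltnNge; apply/negP => pq.
    have qi := ltn_ord q.
    case: up => [|up]; first by lia.
    by have := @partition_leq p.+1 q.+1; lia.
  case=> q; rewrite inE => qp ->; split; first exact: imset_f.
  case: lo => [|lo]; first by lia.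
  by apply: leq_ltn_trans lo; apply: partition_leq; lia.
have p_i1 : (p <= i.+1)%N by [].
have widen_inj : injective (widen_ord p_i1).
  by move=> a b /(congr1 val) /= /ord_inj.
rewrite -[RHS]card_ord -[RHS](card_imset _ widen_inj).
congr #|pred_of_set _|; apply/setP => q; rewrite inE; apply/idP/imsetP.
  by move=> qp; exists (Ordinal qp) => //; apply: val_inj.
by case=> r _ ->; exact: (ltn_ord r).
Qed.

(** The least p with x <= l_(p+1) works: minimality gives l_p < x unless p = 0, where l_0 = 0. *)
Lemma mem_interval (x : 'I_m.+1) : exists p, x \in Defs.interval l p.
Proof.
case/overlapping_partitionP: (lP) => l0 lm _ _.
have ex : exists p, (x <= l (inord p.+1))%N by exists i.+1; rewrite lm leq_ord.
case: (ex_minnP ex) => p xp pmin.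
have p_i : (p < i.+2)%N by rewrite ltnS pmin // lm leq_ord.
exists (Ordinal p_i); rewrite inE lowerE upperE xp andbT.
case: p xp pmin p_i => [|p] xp pmin p_i; first by rewrite l0.
by rewrite leqNgt; apply/negP => /ltnW /pmin; rewrite ltnn.
Qed.

(** Off the cuts the lower bound is strict for p > 0. In particular the interval containing x is
    unique. *)
Lemma count_lt_interval (x : 'I_m.+1) (p : 'I_i.+2) :
  x \notin cuts l -> x \in Defs.interval l p -> count_lt (cuts l) x = p.
Proof.
move=> xl; rewrite inE lowerE upperE => /andP[lo up].
apply: count_lt_cuts => //; last by right.
have [->|p0] := posnP p; [by left | right].
rewrite ltn_neqAle lo andbT; apply: contra xl => /eqP/ord_inj <-.
have p_i : (p.-1 < i.+1)%N by have := ltn_ord p; lia.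
by apply/imsetP; exists (Ordinal p_i) => //=; rewrite prednK.
Qed.

(** The cut l_(q+1) is shared by the consecutive intervals q and q+1, whose indices have opposite
    parities. *)
Lemma mem_interval_cut (q : 'I_i.+1) (b : bool) :
  exists2 p : 'I_i.+2, odd p = b & l (inord q.+1) \in Defs.interval l p.
Proof.
have le := partition_leq; have q_i := ltn_ord q.
have memq (p : 'I_i.+2) : (p <= q.+1 <= p.+1)%N ->
    l (inord q.+1) \in Defs.interval l p.
  by move=> pq; rewrite inE lowerE upperE !le //; lia.
have [<-|nqb] := eqVneq (odd q) b.
  by exists (widen_ord (leqnSn _) q); rewrite ?memq //=; lia.
exists (lift ord0 q); first by rewrite /= /bump; case: (odd q) b nqb => -[].
by apply: memq; rewrite /= /bump /=; lia.
Qed.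

Lemma even_partE : even_part l = even_blocks setT (cuts l).
Proof.
apply/setP => x; rewrite !inE.
have [/imsetP[q _ ->]|xl] := boolP (x \in cuts l).
  have [p p_odd xp] := mem_interval_cut q false.
  by apply/bigcupP; exists p; rewrite ?p_odd.
have [p0 xp0] := mem_interval x; rewrite /= (count_lt_interval xl xp0).
apply/bigcupP/idP => [[p p_even xp]|p0_even]; last by exists p0.
by rewrite -(count_lt_interval xl xp0) (count_lt_interval xl xp).
Qed.

Lemma odd_partE : odd_part l = odd_blocks setT (cuts l).
Proof.
apply/setP => x; rewrite !inE.
have [/imsetP[q _ ->]|xl] := boolP (x \in cuts l).
  have [p p_odd xp] := mem_interval_cut q true.
  by apply/bigcupP; exists p; rewrite ?p_odd.
have [p0 xp0] := mem_interval x; rewrite /= (count_lt_interval xl xp0).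
apply/bigcupP/idP => [[p p_odd' xp]|p0_odd]; last by exists p0.
by rewrite -(count_lt_interval xl xp0) (count_lt_interval xl xp).
Qed.

End Partition.

Lemma count_lt_cut l (q : 'I_i.+1) : overlapping_partition l ->
  count_lt (cuts l) (l (inord q.+1)) = q.
Proof.
move=> lP; have q_i := ltn_ord q.
apply: count_lt_cuts => //; [by lia | | by right].
have [->|q0] := posnP q; [by left | right].
by rewrite partition_ltn //; lia.
Qed.

(** The index of a cut is its rank in the set of cuts ([count_lt_cut]), so the set determines every
    interior endpoint. *)
Lemma cuts_inj : {in [pred l | overlapping_partition l] &, injective cuts}.
Proof.
move=> l1 l2; rewrite !inE => l1P l2P e; apply/ffunP => p.
rewrite -[p]inord_val; case: (p : nat) (ltn_ord p) => [_|q].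
  case/overlapping_partitionP: l1P => -> _ _ _.
  by case/overlapping_partitionP: l2P => -> _ _ _.
rewrite !ltnS leq_eqVlt => /orP[/eqP ->|q_i].
  case/overlapping_partitionP: l1P => _ -> _ _.
  by case/overlapping_partitionP: l2P => _ -> _ _.
have : l1 (inord (Ordinal q_i).+1) \in cuts l2.
  by rewrite -e; apply/imsetP; exists (Ordinal q_i).
case/imsetP=> r _ er; have := count_lt_cut (Ordinal q_i) l1P.
by rewrite er e count_lt_cut //= => rq; move: er; rewrite /= rq.
Qed.

Lemma cuts_onto (L : {set 'I_m.+1}) : #|L| = i.+1 ->
  exists2 l, overlapping_partition l & L = cuts l.
Proof.
move=> cL; have szL : size (enum L) = i.+1 by rewrite -cardE.
pose l : {ffun 'I_i.+3 -> 'I_m.+1} :=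
  (* The interior endpoint l_p is the element of [L] at position p-1, positions starting at 0. *)
  [ffun p : 'I_i.+3 => if p == 0 :> nat then ord0 else
                       if p == i.+2 :> nat then ord_max else
                       nth ord0 (enum L) p.-1].
have lE p : (p < i.+1)%N -> l (inord p.+1) = nth ord0 (enum L) p.
  by move=> p_i; rewrite ffunE inordK /= ?ifN //; lia.
have l0 : l (inord 0) = ord0 by rewrite ffunE inordK.
have lm : l (inord i.+2) = ord_max by rewrite ffunE inordK //= eqxx.
have lt p : (0 < p < i.+1)%N -> (l (inord p) < l (inord p.+1))%N.
  case: p => // p /andP[_ p_i]; rewrite !lE; try lia.
  have := sorted_ltn_enum L; rewrite sorted_map => srt.
  apply: (sorted_ltn_nth _ _ srt); rewrite ?inE ?szL //; try lia.
  by move=> ? ? ? /=; apply: ltn_trans.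
exists l.
  apply/overlapping_partitionP; split=> // p p_i.
  have [->|p0] := posnP p; first by rewrite l0.
  have [pi|pi] := ltnP p i.+1; first by apply: ltnW; apply: lt; rewrite p0.
  by rewrite (_ : p = i.+1) ?lm ?leq_ord //; lia.
apply/setP => x; apply/idP/imsetP => [xL|[p _ ->]].
  have x_i : (index x (enum L) < i.+1)%N by rewrite -szL index_mem mem_enum.
  by exists (Ordinal x_i) => //=; rewrite lE // nth_index // mem_enum.
by rewrite lE // -mem_enum mem_nth // szL.
Qed.

Lemma sum_overlapping_partition (V : zmodType) (F : {set 'I_m.+1} -> V) :
  \sum_(l | overlapping_partition l) F (cuts l)
  = \sum_(L : {set 'I_m.+1} | #|L| == i.+1) F L.
Proof.
rewrite -(big_imset F cuts_inj); apply: eq_bigl => L.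
apply/imsetP/eqP => [[l lP ->]|/cuts_onto[l lP ->]]; first exact: card_cuts.
by exists l.
Qed.

End Cuts.

(** * Relabelling *)

Section Transport.

Variables (m n : nat) (v : 'I_m.+1 -> 'I_n.+1).
Hypothesis ltn_v : forall x y, (v x < v y)%N = (x < y)%N.
Implicit Types L E T : {set 'I_m.+1}.

Lemma incr_inj : injective v.
Proof.
by move=> x y e; apply: ord_inj; case: (ltngtP x y); rewrite -?ltn_v ?e ?ltnn.
Qed.

Lemma count_lt_imset L x : count_lt (v @: L) (v x) = count_lt L x.
Proof.
rewrite /count_lt -(card_imset [set s in L | (s < x)%N] incr_inj).
congr #|pred_of_set _|; apply/setP => y; rewrite inE; apply/andP/imsetP.
  by case=> /imsetP[z zL ->]; rewrite ltn_v => zx; exists z; rewrite ?inE ?zL.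
by case=> z; rewrite inE => /andP[zL zx] ->; rewrite ltn_v imset_f.
Qed.

Lemma count_gt_imset L x : count_gt (v @: L) (v x) = count_gt L x.
Proof.
rewrite /count_gt -(card_imset [set s in L | (x < s)%N] incr_inj).
congr #|pred_of_set _|; apply/setP => y; rewrite inE; apply/andP/imsetP.
  by case=> /imsetP[z zL ->]; rewrite ltn_v => zx; exists z; rewrite ?inE ?zL.
by case=> z; rewrite inE => /andP[zL zx] ->; rewrite ltn_v imset_f.
Qed.

Lemma even_blocks_imset T L :
  v @: even_blocks T L = even_blocks (v @: T) (v @: L).
Proof.
rewrite /even_blocks imsetU; congr (_ :|: _); apply/setP => y; rewrite !inE.
apply/imsetP/andP => [[x]|[/andP[yL /imsetP[x xT e]] yc]].
  rewrite !inE => /andP[/andP[xL xT] xc] ->.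
  by rewrite count_lt_imset (mem_imset _ _ incr_inj) xL imset_f.
exists x => //; rewrite !inE xT -count_lt_imset -e yc andbT.
by rewrite e (mem_imset _ _ incr_inj) in yL; rewrite yL.
Qed.

Lemma odd_blocks_imset T L :
  v @: odd_blocks T L = odd_blocks (v @: T) (v @: L).
Proof.
rewrite /odd_blocks imsetU; congr (_ :|: _); apply/setP => y; rewrite !inE.
apply/imsetP/andP => [[x]|[/andP[yL /imsetP[x xT e]] yc]].
  rewrite !inE => /andP[/andP[xL xT] xc] ->.
  by rewrite count_lt_imset (mem_imset _ _ incr_inj) xL imset_f.
exists x => //; rewrite !inE xT -count_lt_imset -e yc andbT.
by rewrite e (mem_imset _ _ incr_inj) in yL; rewrite yL.
Qed.

Lemma sum_count_gt_imset T E :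
  (\sum_(y in v @: T :\: v @: E) count_gt (v @: E) y
   = \sum_(y in T :\: E) count_gt E y)%N.
Proof.
have -> : v @: T :\: v @: E = v @: (T :\: E).
  apply/setP => y; rewrite inE; apply/andP/imsetP.
    case=> yE /imsetP[x xT e]; exists x; rewrite // inE xT andbT.
    by apply: contra yE => xE; rewrite e imset_f.
  case=> x; rewrite inE => /andP[xE xT] ->.
  by rewrite (mem_imset _ _ incr_inj) xE imset_f.
rewrite big_imset /=; last by move=> x y _ _ /incr_inj.
by apply: eq_bigr => y _; rewrite count_gt_imset.
Qed.

Lemma sum_imset_subsets (V : zmodType) k (F : {set 'I_n.+1} -> V) :
  \sum_(L : {set 'I_m.+1} | #|L| == k) F (v @: L)
  = \sum_(L : {set 'I_n.+1} | (L \subset v @: setT) && (#|L| == k)) F L.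
Proof.
have inj_imset : {in [pred L : {set 'I_m.+1} | #|L| == k] &,
    injective (fun L => v @: L)}.
  by move=> L1 L2 _ _; apply: imset_inj; apply: incr_inj.
rewrite -(big_imset F inj_imset); apply: eq_bigl => L.
apply/imsetP/andP => [[K /eqP cK ->]|[/subsetP sL cL]].
  by rewrite imsetS ?subsetT // card_imset ?cK //; apply: incr_inj.
have eL : L = v @: (v @^-1: L).
  apply/setP => y; apply/idP/imsetP => [yL|[x]]; last by rewrite inE => xL ->.
  by have /imsetP[x _ e] := sL y yL; exists x; rewrite // inE -e.
by exists (v @^-1: L) => //; rewrite inE -(card_imset _ incr_inj) -eL.
Qed.

End Transport.

Lemma ltn_vertex n (S : {set 'I_n.+1}) : S != set0 ->
  forall x y, (vertex S x < vertex S y)%N = (x < y)%N.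
Proof.
rewrite -card_gt0 => S0.
have szS (x : 'I_#|S|.-1.+1) : (x < size (enum S))%N.
  by rewrite -cardE; have := ltn_ord x; lia.
have homo (x y : 'I_#|S|.-1.+1) : (x < y)%N -> (vertex S x < vertex S y)%N.
  have := sorted_ltn_enum S; rewrite sorted_map => srt.
  apply: (sorted_ltn_nth (leT := relpre val ltn) _ _ srt); rewrite ?inE ?szS //.
  by move=> ? ? ? /=; apply: ltn_trans.
move=> x y; apply/idP/idP; last exact: homo.
case: (ltngtP x y) => // [/homo yx|/ord_inj ->]; last by rewrite ltnn.
by move/ltnW; rewrite leqNgt yx.
Qed.

Lemma vertex_imset n (S : {set 'I_n.+1}) : S != set0 ->
  vertex S @: setT = S.
Proof.
move=> S0; apply/eqP; rewrite eqEcard; apply/andP; split.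
  apply/subsetP => _ /imsetP[x _ ->]; rewrite -mem_enum mem_nth // -cardE.
  by apply: leq_trans (ltn_ord x) _; rewrite prednK ?card_gt0.
rewrite card_imset ?cardsT ?card_ord; last exact: incr_inj (ltn_vertex S0).
by rewrite prednK ?card_gt0.
Qed.

(** Replacing partitions by their cuts and transporting along [vertex] puts the Steenrod sum on the
    index set of the Bruhat sum, so the two can be compared term by term. *)
Lemma steenrod_faceE n i (S : {set 'I_n.+1}) : S != set0 ->
  steenrod_face i S =
  \sum_(L : {set 'I_n.+1} | (L \subset S) && (#|L| == i.+1))
    (-1) ^+ (\sum_(y in S :\: even_blocks S L) count_gt (even_blocks S L) y
             + i * #|S|.-1)%N *:
      tensor (basis_chain (even_blocks S L)) (basis_chain (odd_blocks S L)).
Proof.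
move=> S0; set F := BIG_F.
(* Writing [S] as the image of [vertex] lets subsets of [S] be pulled back to subsets of [0,m]. *)
transitivity (\sum_(L : {set 'I_n.+1} |
    (L \subset vertex S @: setT) && (#|L| == i.+1)) F L); last first.
  by rewrite vertex_imset.
rewrite -(sum_imset_subsets (ltn_vertex S0)).
rewrite -(sum_overlapping_partition i (fun L => F (vertex S @: L))).
apply: eq_bigr => l lP; rewrite {}/F.
have -> : even_blocks S (vertex S @: cuts l) = vertex S @: even_part l.
  by rewrite even_partE // (even_blocks_imset (ltn_vertex S0)) vertex_imset.
have -> : odd_blocks S (vertex S @: cuts l) = vertex S @: odd_part l.
  by rewrite odd_partE // (odd_blocks_imset (ltn_vertex S0)) vertex_imset.
congr (_ *: _); rewrite /steenrod_sign odd_rearrangement !exprD signr_odd.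
have := sum_count_gt_imset (ltn_vertex S0) setT (even_part l).
by rewrite vertex_imset // setTD => ->.
Qed.

(** * Comparison of the signs *)

(** Both sides count the pairs x < y with x in [X] and y in [Y]. *)
Lemma sum_count_gt_exchange n (X Y : {set 'I_n.+1}) :
  (\sum_(x in X) count_gt Y x = \sum_(y in Y) count_lt X y)%N.
Proof.
under eq_bigr do rewrite /count_gt -sum1dep_card big_mkcondr.
rewrite exchange_big; apply: eq_bigr => y yY /=.
by rewrite -big_mkcondr /count_lt -sum1dep_card.
Qed.

Lemma count_lt_gt n (X : {set 'I_n.+1}) x :
  x \notin X -> (count_lt X x + count_gt X x = #|X|)%N.
Proof.
move=> xX; rewrite -(cardsID [set s in X | (s < x)%N] X) /count_lt /count_gt.
congr (_ + _)%N; apply: eq_card => y; rewrite !inE.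
  by case: (y \in X).
have [->|yx] := eqVneq y x; first by rewrite (negbTE xX) andbF.
rewrite -val_eqE in yx.
by rewrite andbC; case: (y \in X) => //=; case: ltngtP yx.
Qed.

Lemma sum_count_ltD n (X B : {set 'I_n.+1}) : [disjoint X & B] ->
  (\sum_(b in B) count_lt X b + \sum_(b in B) count_gt X b = #|B| * #|X|)%N.
Proof.
move=> dXB; rewrite -big_split /= -sum_nat_const; apply: eq_bigr => b bB.
by rewrite count_lt_gt // (disjointFl dXB bB).
Qed.

(** Exchanging one of the two copies turns it into a sum of [count_gt]; each l then contributes the
    number of other elements of [L]. *)
Lemma sum_count_lt_self n (L : {set 'I_n.+1}) :
  (2 * \sum_(l in L) count_lt L l = #|L| * #|L|.-1)%N.
Proof.
rewrite mul2n -addnn -{2}sum_count_gt_exchange -big_split /= -sum_nat_const.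
apply: eq_bigr => l lL; rewrite (cardsD1 l L) lL /=.
rewrite -(@count_lt_gt _ (L :\ l) l) ?inE ?eqxx // /count_lt /count_gt.
rewrite add0n; congr addn; apply: eq_card => y; rewrite !inE.
all: by have [->|] := eqVneq y l; rewrite ?ltnn ?andbF.
Qed.

(** The sum i(i+1)/2 is an odd multiple of [uphalf i]: it is (2k+1)k for i = 2k and (2k+1)(k+1) for
    i = 2k+1. *)
Lemma odd_sum_count_lt_self n i (L : {set 'I_n.+1}) : #|L| = i.+1 ->
  odd (\sum_(l in L) count_lt L l) = odd (uphalf i).
Proof.
move=> cL; have := sum_count_lt_self L; rewrite cL /=.
move: (\sum_(l in L) _)%N => s e; have := odd_double_half i.
rewrite uphalf_half; move: (i./2) (odd i) => k [] /= ik; rewrite -ik in e.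
  by rewrite (_ : s = k.*2.+1 * k.+1)%N ?oddM /= ?odd_double //; nia.
by rewrite (_ : s = k.*2.+1 * k)%N ?oddM /= ?odd_double //; nia.
Qed.

Lemma count_gtU n (X Y : {set 'I_n.+1}) x : [disjoint X & Y] ->
  count_gt (X :|: Y) x = (count_gt X x + count_gt Y x)%N.
Proof.
move=> dXY; rewrite /count_gt -cardsUI addnC.
rewrite (_ : _ :&: _ = set0) ?cards0 ?add0n; last first.
  apply/setP => y; rewrite !inE; have [yX|] := boolP (y \in X) => //=.
  by rewrite (disjointFr dXY yX) andbF.
by apply: eq_card => y; rewrite !inE andb_orl.
Qed.

Lemma odd_sum_const (I : finType) (X : {set I}) (f : I -> nat) (c : bool) :
  (forall x, x \in X -> odd (f x) = c) ->
  odd (\sum_(x in X) f x) = c && odd #|X|.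
Proof.
move=> fc; rewrite (big_morph _ oddD (erefl : odd 0 = false)).
rewrite (eq_bigr (fun=> c) fc) -sum1_card.
rewrite (big_morph _ oddD (erefl : odd 0 = false)).
case: c {fc}; first by [].
by rewrite big1.
Qed.

Lemma swap_tensor n (X Y : {set 'I_n.+1}) :
  swap (tensor (basis_chain X) (basis_chain Y))
  = (-1) ^+ (#|X|.-1 * #|Y|.-1) *: tensor (basis_chain Y) (basis_chain X).
Proof.
apply/ffunP => -[F G]; rewrite !ffunE /= /deg.
have [->|] := eqVneq (val F) Y; last by rewrite mulr0 mul0r mulr0 scaler0.
have [->|] := eqVneq (val G) X; last by rewrite mul0r !mulr0 scaler0.
by rewrite mulnC.
Qed.

Lemma swapZ n (a : int) (t : chain2 n) : swap (a *: t) = a *: swap t.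
Proof. by apply/ffunP => p; rewrite !ffunE /= mulrCA. Qed.

Lemma swap_sum n (I : finType) (P : pred I) (t : I -> chain2 n) :
  swap (\sum_(j | P j) t j) = \sum_(j | P j) swap (t j).
Proof.
apply: (big_morph (@swap n)) => [s u|]; apply/ffunP => p; rewrite !ffunE.
  by rewrite mulrDr.
by rewrite mulr0.
Qed.

(** * Termwise comparison of the two coproducts *)

Section FaceCoproducts.

(** The constant [u] treats both extreme sets at once: false for the empty set, true for the full
    one. *)
Variables (n i : nat) (U : bruhat n i.+1) (u : bool).
Hypothesis mem_U : forall K : {set 'I_n.+1}, #|K| = i.+2 -> (K \in val U) = u.

Section Summand.

Variables S L : {set 'I_n.+1}.
Hypotheses (sLS : L \subset S) (cL : #|L| = i.+1).
Let A := partA U S L.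
Let B := partB U S L.

Lemma mem_partA x :
  (x \in A) = [&& x \notin L, x \in S & odd (count_gt L x) (+) u].
Proof.
rewrite inE in_setD andbA; case: (boolP (x \notin L)) => //= xL.
rewrite mem_U ?cardsU1 ?xL ?cL //.
by case: (x \in S) u (odd _) => [] [] [].
Qed.

Lemma mem_partB x :
  (x \in B) = [&& x \notin L, x \in S & ~~ (odd (count_gt L x) (+) u)].
Proof.
rewrite in_setD in_setU negb_or mem_partA.
by case: (x \in L) (x \in S) => [] [] //=; rewrite andbT.
Qed.

Lemma disjLA : [disjoint L & A].
Proof.
rewrite -setI_eq0; apply/eqP/setP => x; rewrite in_setI mem_partA !inE.
by case: (x \in L).
Qed.

Lemma disjLB : [disjoint L & B].
Proof.
rewrite -setI_eq0; apply/eqP/setP => x; rewrite in_setI mem_partB !inE.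
by case: (x \in L).
Qed.

Lemma disjAB : [disjoint A & B].
Proof.
rewrite -setI_eq0; apply/eqP/setP => x; rewrite in_setI mem_partA mem_partB inE.
by case: (x \in L) (x \in S) (_ (+) u) => [] [] [].
Qed.

Lemma setDLA : S :\: (L :|: A) = B. Proof. by []. Qed.

Lemma setDLB : S :\: (L :|: B) = A.
Proof.
apply/setP => x; rewrite in_setD in_setU mem_partA mem_partB.
by case: (x \in L) (x \in S) (_ (+) u) => [] [] [].
Qed.

Lemma card_partition : #|S| = (i.+1 + #|A| + #|B|)%N.
Proof.
rewrite -(cardsID (L :|: A) S) setDLA -cL; congr (_ + _)%N.
have -> : S :&: (L :|: A) = L :|: A.
  apply/setIidPr; rewrite subUset sLS; apply/subsetP => x.
  by rewrite mem_partA => /and3P[].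
by rewrite cardsU disjoint_setI0 ?disjLA // cards0 subn0.
Qed.

Lemma odd_sum_partA : odd (\sum_(a in A) count_gt L a) = ~~ u && odd #|A|.
Proof.
apply: odd_sum_const => x; rewrite mem_partA => /and3P[_ _].
by case: u (odd _) => [] [].
Qed.

Lemma odd_sum_partB : odd (\sum_(b in B) count_gt L b) = u && odd #|B|.
Proof.
apply: odd_sum_const => x; rewrite mem_partB => /and3P[_ _].
by case: u (odd _) => [] [].
Qed.

Lemma odd_bruhat_sign :
  odd (bruhat_sign S L A B) =
  odd (\sum_(b in B) count_lt A b) (+) odd (uphalf i)
  (+) (odd (i.+1 + #|A| + #|B|) && odd #|A|).
Proof.
rewrite /bruhat_sign !oddD (odd_sum_count_lt_self cL) card_partition oddM.
by rewrite !oddD.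
Qed.

Lemma odd_count_lt x : x \notin L ->
  odd (count_lt L x) = odd i.+1 (+) odd (count_gt L x).
Proof. by move=> xL; rewrite -cL -(count_lt_gt xL) oddD addbK. Qed.

Lemma even_blocks_straight : u = odd i -> even_blocks S L = L :|: A.
Proof.
move=> ui; apply/setP => x; rewrite in_setU [in RHS]in_setU mem_partA !inE.
case: (boolP (x \in L)) => //= xL; rewrite odd_count_lt // ui /=.
by case: (odd i) (odd (count_gt L x)) => [] [].
Qed.

Lemma odd_blocks_straight : u = odd i -> odd_blocks S L = L :|: B.
Proof.
move=> ui; apply/setP => x; rewrite in_setU [in RHS]in_setU mem_partB !inE.
case: (boolP (x \in L)) => //= xL; rewrite odd_count_lt // ui /=.
by case: (odd i) (odd (count_gt L x)) => [] [].
Qed.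

Lemma even_blocks_swapped : u = ~~ odd i -> even_blocks S L = L :|: B.
Proof.
move=> ui; apply/setP => x; rewrite in_setU [in RHS]in_setU mem_partB !inE.
case: (boolP (x \in L)) => //= xL; rewrite odd_count_lt // ui /=.
by case: (odd i) (odd (count_gt L x)) => [] [].
Qed.

Lemma odd_blocks_swapped : u = ~~ odd i -> odd_blocks S L = L :|: A.
Proof.
move=> ui; apply/setP => x; rewrite in_setU [in RHS]in_setU mem_partA !inE.
case: (boolP (x \in L)) => //= xL; rewrite odd_count_lt // ui /=.
by case: (odd i) (odd (count_gt L x)) => [] [].
Qed.

(** Modulo 2, the elements of [L] above those of [B] contribute i|B|, the pairs in A x B add up to
    |A||B|, and [uphalf i] differs from [i./2] by i. With |S|-1 = i+|A|+|B| all terms cancel. *)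
Lemma bruhat_sign_straight : u = odd i ->
  odd (bruhat_sign S L A B) =
  odd (i./2 + (\sum_(b in B) count_gt (L :|: A) b + i * #|S|.-1)).
Proof.
move=> ui; rewrite odd_bruhat_sign.
rewrite (eq_bigr _ (fun x _ => count_gtU x disjLA)).
have -> : #|S|.-1 = (i + #|A| + #|B|)%N by rewrite card_partition.
have /(congr1 odd) := sum_count_ltD disjAB; rewrite oddD oddM => e.
rewrite big_split /= !(oddD, oddM) odd_sum_partB ui uphalf_half oddD oddb /=.
move: (odd (\sum_(b in B) count_lt A b)) (odd (\sum_(b in B) count_gt A b)) e.
by case: (odd i) (odd i./2) (odd #|A|) (odd #|B|) => [] [] [] [] [] [].
Qed.

(** Here the pairs a < b are counted identically on both sides, and the elements of [L] above those
    of [A] contribute i|A| modulo 2. The rest is balanced by the sign of T, whose exponent is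
    (i+|A|)(i+|B|). *)
Lemma bruhat_sign_swapped : u = ~~ odd i ->
  odd (bruhat_sign S L A B) =
  odd (uphalf i + (\sum_(a in A) count_gt (L :|: B) a + i * #|S|.-1)
       + #|L :|: B|.-1 * #|L :|: A|.-1).
Proof.
move=> ui; rewrite odd_bruhat_sign.
rewrite (eq_bigr _ (fun x _ => count_gtU x disjLB)).
have -> : #|S|.-1 = (i + #|A| + #|B|)%N by rewrite card_partition.
rewrite !cardsU !disjoint_setI0 ?disjLA ?disjLB // cards0 !subn0 cL.
rewrite big_split /= (sum_count_gt_exchange A B) !(oddD, oddM).
rewrite odd_sum_partA ui /=.
move: (odd (\sum_(_ in _) _)) (odd (uphalf i)).
by case: (odd i) (odd #|A|) (odd #|B|) => [] [] [] [] [].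
Qed.

End Summand.

(** The condition on [u] gathers the two cases without T: the empty set for even i and the full set
    for odd i. *)
Lemma bruhat_face_straight (S : {set 'I_n.+1}) : S != set0 -> u = odd i ->
  bruhat_coproduct_face U S = (-1) ^+ i./2 *: steenrod_face i S.
Proof.
move=> S0 ui; rewrite steenrod_faceE // scaler_sumr.
apply: eq_bigr => L /andP[sLS /eqP cL].
rewrite even_blocks_straight // odd_blocks_straight // scalerA -exprD.
by rewrite -signr_odd bruhat_sign_straight // signr_odd.
Qed.

Lemma bruhat_face_swapped (S : {set 'I_n.+1}) : S != set0 -> u = ~~ odd i ->
  bruhat_coproduct_face U S = (-1) ^+ uphalf i *: swap (steenrod_face i S).
Proof.
move=> S0 ui; rewrite steenrod_faceE // swap_sum scaler_sumr.
apply: eq_bigr => L /andP[sLS /eqP cL].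
rewrite even_blocks_swapped // odd_blocks_swapped // swapZ swap_tensor.
(* The even part is now L u B, so the vertices outside it form [A]. *)
rewrite !scalerA -!exprD setDLB //.
by rewrite -signr_odd bruhat_sign_swapped // signr_odd.
Qed.

Lemma bruhat_coproduct_straight (c : chain n) : u = odd i ->
  bruhat_coproduct U c = (-1) ^+ i./2 *: steenrod n i c.
Proof.
move=> ui; rewrite scaler_sumr; apply: eq_bigr => F _.
by rewrite bruhat_face_straight ?(valP F) // !scalerA mulrC.
Qed.

Lemma bruhat_coproduct_swapped (c : chain n) : u = ~~ odd i ->
  bruhat_coproduct U c = (-1) ^+ uphalf i *: swap (steenrod n i c).
Proof.
move=> ui; rewrite swap_sum scaler_sumr; apply: eq_bigr => F _.
by rewrite bruhat_face_swapped ?(valP F) // swapZ !scalerA mulrC.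
Qed.

End FaceCoproducts.

Theorem theorem3p5 (n i : nat) :
  (~~ odd i ->
     (forall c : chain n,
        bruhat_coproduct (bruhat0 n i.+1) c = (-1) ^+ i./2 *: steenrod n i c)
     /\ (forall c : chain n,
        bruhat_coproduct (bruhat_full n i.+1) c
        = (-1) ^+ i./2 *: swap (steenrod n i c)))
  /\ (odd i ->
     (forall c : chain n,
        bruhat_coproduct (bruhat0 n i.+1) c
        = (-1) ^+ uphalf i *: swap (steenrod n i c))
     /\ (forall c : chain n,
        bruhat_coproduct (bruhat_full n i.+1) c
        = (-1) ^+ i./2 *: steenrod n i c)).
Proof.
have mem0 (K : {set 'I_n.+1}) :
    #|K| = i.+2 -> (K \in val (bruhat0 n i.+1)) = false by rewrite inE.
have mem_full (K : {set 'I_n.+1}) :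
    #|K| = i.+2 -> (K \in val (bruhat_full n i.+1)) = true.
  by rewrite inE => /eqP.
split=> i_odd; split=> c.
- by rewrite (bruhat_coproduct_straight mem0) // (negbTE i_odd).
- rewrite (bruhat_coproduct_swapped mem_full) ?i_odd //.
  (* For even i the two halves agree, so the constant is [i./2]. *)
  by rewrite uphalf_half (negbTE i_odd).
- by rewrite (bruhat_coproduct_swapped mem0) // i_odd.
- by rewrite (bruhat_coproduct_straight mem_full) // i_odd.
Qed.
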